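(* Let $a,b\ge 1$ be integers, let $h=[a+1,\underbrace{1,\dots,1}_{b}]$ (a hook with $a+1$ columns and $b+1$ rows, $n=a+b+1$ boxes), and suppose $h$ is $(k,r)$-admissible and $a+b<r-1$. Then there is a character $\psi:B_n\to U(1)$ such that $\rho_h^{(k,r)}$ is equivalent to $\psi\otimes\wedge^b\rho_{[a+b,1]}^{(2,r)}$, the tensor product of $\psi$ with the $b$-th exterior power of the Burau representation $\rho_{[a+b,1]}^{(2,r)}$ of $B_n$.
   Context: Fix an integer $r\ge 3$ and let $q=e^{2\pi i/r}$ or $q=e^{-2\pi i/r}$, with $q^{1/2}=e^{\pm\pi i/r}$ (same sign) and $q^{m/2}=(q^{1/2})^m$. Quantum integers: $[m]=\frac{q^{m/2}-q^{-m/2}}{q^{1/2}-q^{-1/2}}$. A Young diagram $\lambda=[\lambda_1,\dots,\lambda_k]$, $\lambda_1\ge\dots\ge\lambda_k\ge0$, has $n=\sum\lambda_i$ boxes; a standard tableau is a filling by $1,\dots,n$ increasing along rows and columns. For $r\ge k+1$, $\lambda$ (at most $k$ rows) is $(k,r)$-admissible if $\lambda_1-\lambda_k\le r-k$. For a standard tableau $t$, $t^{(i)}$ is obtained by deleting boxes containing $n,\dots,n-i+1$; $t$ is $(k,r)$-admissible if every $t^{(i)}$ has $(k,r)$-admissible shape. If entries $m,m'$ lie in rows $r_1,r_2$ and columns $c_1,c_2$, $d_{t,m,m'}=(c_1-c_2)-(r_1-r_2)$; with $d=d_{t,i,i+1}$ put $\alpha_{t,i}=\frac{[d+1]}{[2][d]}$,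 $\beta_{t,i}=\sqrt{\alpha_{t,i}(1-\alpha_{t,i})}$. $V_\lambda^{(k,r)}$ has orthonormal basis $\{v_t\}$ over $(k,r)$-admissible standard tableaux $t$ of shape $\lambda$; $s_i(t)$ swaps $i,i+1$; $E_iv_t=\alpha_{t,i}v_t+\beta_{t,i}v_{s_i(t)}$ if $s_i(t)$ is an admissible standard tableau, else $E_iv_t=\alpha_{t,i}v_t$. The Jones–Wenzl sector $\rho_\lambda^{(k,r)}:B_n\to U(V_\lambda^{(k,r)})$ is $\sigma_i\mapsto q\,\mathrm{Id}-(1+q)E_i$. The representation $\rho_{[m,1]}^{(2,r)}$ is called a Burau representation. *)

(* Defs.v *)
From HB Require Import structures.
From mathcomp Require Import all_boot all_order all_algebra.
From mathcomp Require Import fingroup perm complex.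
From mathcomp Require Import reals trigo.
Set Implicit Arguments. Unset Strict Implicit. Unset Printing Implicit Defensive.
Import Order.TTheory GRing.Theory Num.Theory.
Local Open Scope ring_scope.

Section JonesWenzl.
Variable R : realType.
Local Notation C := (R[i]).

Definition qhalf (r : nat) (sgn : bool) : C :=
  Complex (cos (pi / r%:R)) ((if sgn then 1 else -1) * sin (pi / r%:R)).

Definition qint (z : C) (m : int) : C := (z ^ m - z ^ (- m)) / (z - z ^ (-1)).

(* A Young diagram with at most k rows is a list lam of row lengths
   (entries with index >= size lam are 0). *)
Definition young (k : nat) (lam : seq nat) : bool :=
  sorted (fun x y => y <= x)%N lam && all (fun x => x == 0%N) (drop k lam).

Definition admissible (k r : nat) (lam : seq nat) : bool :=
  [&& (k.+1 <= r)%N, young k lam & (nth 0 lam 0 - nth 0 lam k.-1 <= r - k)%N].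

(* ---------- Tableaux with n = N.+1 boxes ----------
   A filling t assigns to each entry m (0-based, i.e. entry m+1) its box
   (row, column) (0-based). *)
Definition filling (k N : nat) := {ffun 'I_N.+1 -> 'I_k * 'I_N.+1}.

Definition std_tableau (k N : nat) (lam : seq nat) (t : filling k N) : bool :=
  [&& sumn lam == N.+1, injectiveb t,
      [forall x : 'I_k * 'I_N.+1, (x \in codom t) == (x.2 < nth 0 lam x.1)%N],
      [forall m, forall m', (((t m).1 == (t m').1) && ((t m).2 < (t m').2)%N) ==> (m < m')%N]
    &
      [forall m, forall m', (((t m).2 == (t m').2) && ((t m).1 < (t m').1)%N) ==> (m < m')%N]].

Definition trunc_shape (k N : nat) (t : filling k N) (i : nat) : seq nat :=
  [seq #|[set m : 'I_N.+1 | (m < N.+1 - i)%N && ((t m).1 == j :> nat)]| | j <- iota 0 k].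

Definition adm_tableau (k r N : nat) (t : filling k N) : bool :=
  all (fun i => admissible k r (trunc_shape t i)) (iota 0 N.+2).

Definition adm_std (k r N : nat) (lam : seq nat) (t : filling k N) : bool :=
  std_tableau lam t && adm_tableau r t.

(* basis of V_lam^{(k,r)} : admissible standard tableaux of shape lam *)
Definition Tab (k r N : nat) (lam : seq nat) := {t : filling k N | adm_std r lam t}.

Definition swap_ent (k N : nat) (i : 'I_N) (t : filling k N) : filling k N :=
  [ffun m => t (tperm (inord i : 'I_N.+1) (inord i.+1) m)].

Definition dcont (k N : nat) (t : filling k N) (m m' : 'I_N.+1) : int :=
  (((t m).2 : nat)%:Z - ((t m').2 : nat)%:Z) - (((t m).1 : nat)%:Z - ((t m').1 : nat)%:Z).

Definition alpha (z : C) (k N : nat) (t : filling k N) (i : 'I_N) : C :=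
  let d := dcont t (inord i) (inord i.+1) in
  qint z (d + 1) / (qint z 2 * qint z d).

Definition beta (z : C) (k N : nat) (t : filling k N) (i : 'I_N) : C :=
  sqrtC (alpha z t i * (1 - alpha z t i)).

(* ---------- linear operators on the span of a finite basis T ----------
   A u v = coefficient of basis vector u in the image of basis vector v *)
Definition op (T1 T2 : finType) := T1 -> T2 -> C.

Definition opmul (T1 T2 T3 : finType) (A : op T1 T2) (B : op T2 T3) : op T1 T3 :=
  fun u v => \sum_(w : T2) A u w * B w v.

Definition opid (T : finType) : op T T := fun u v => (u == v)%:R.

Definition Eop (z : C) (k r N : nat) (lam : seq nat) (i : 'I_N) : op (Tab k r N lam) (Tab k r N lam) :=
  fun u t => (u == t)%:R * alpha z (val t) i
             + (val u == swap_ent i (val t))%:R * beta z (val t) i.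

(* Jones--Wenzl sector: sigma_{i+1} |-> q Id - (1+q) E_i, with q = z^2, for i : 'I_N
   (generators sigma_1, ..., sigma_{n-1} of B_n, n = N.+1) *)
Definition rhoJW (z : C) (k r N : nat) (lam : seq nat) (i : 'I_N) : op (Tab k r N lam) (Tab k r N lam) :=
  fun u v => (z ^+ 2) * opid u v - (1 + z ^+ 2) * @Eop z k r N lam i u v.

Definition ExtIdx (T : finType) (b : nat) := {S : {set T} | #|S| == b}.

Definition optop (T : finType) (A : op T T) (x y : option T) : C :=
  match x, y with Some x, Some y => A x y | _, _ => 0 end.

(* (wedge^b A)(S, S') = det of the minor A[S, S'], with S, S' listed in the
   (fixed) enumeration order of T: the matrix of wedge^b A in the basis
   e_{s_1} /\ ... /\ e_{s_b}. *)
Definition ext_pow (T : finType) (b : nat) (A : op T T) : op (ExtIdx T b) (ExtIdx T b) :=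
  fun S S' => \det (\matrix_(i < b, j < b)
     optop A (nth None (map Some (enum (val S))) i) (nth None (map Some (enum (val S'))) j)).

(* a character psi : B_n -> U(1), given by the images of the generators *)
Definition braid_character (N : nat) (psi : 'I_N -> C) : Prop :=
  (forall i, `|psi i| = 1) /\
  (forall i j : 'I_N, j = i.+1 :> nat -> psi i * psi j * psi i = psi j * psi i * psi j) /\
  (forall i j : 'I_N, (i.+1 < j)%N -> psi i * psi j = psi j * psi i).

(* two representations of B_n, given on the generators, are equivalent *)
Definition rep_equiv (N : nat) (T1 T2 : finType) (A : 'I_N -> op T1 T1) (B : 'I_N -> op T2 T2) : Prop :=
  exists (P : op T2 T1) (Q : op T1 T2),
    (forall u v, opmul P Q u v = opid u v) /\
    (forall u v, opmul Q P u v = opid u v) /\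
    (forall i u v, opmul P (A i) u v = opmul (B i) P u v).

End JonesWenzl.

Definition hook (a b : nat) : seq nat := a.+1 :: nseq b 1%N.

(* Main.v *)
Require Import Defs.
From HB Require Import structures.
From mathcomp Require Import all_boot all_order all_algebra.
From mathcomp Require Import fingroup perm complex ring zify.
From mathcomp Require Import reals trigo.
Set Implicit Arguments. Unset Strict Implicit. Unset Printing Implicit Defensive.
Import Order.TTheory GRing.Theory Num.Theory.
Local Open Scope ring_scope.

(* Since a + b < r - 1, every standard tableau of hook shape is admissible, and it
   is determined by the set X of its entries outside the first row (entries are
   0-based, so X is any b-element set not containing 0). The axial distance of
   i and i + 1 is 1, -1 or +-(i + 1) according to which of them lie in X, hence
   sigma_i acts on v_X by q (neither in X), by -1 (both in X), or by a 2x2 block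
   of determinant -q that depends on i only (exactly one in X). The Burau
   representation is the case b = 1, and its b-th exterior power acts by q^b,
   by q^(b-2) * (-q), and by q^(b-1) times the same block. So the character
   sigma_i |-> q^-(b-1) works. Wedge products are enumerated in an arbitrary order
   of the Burau tableaux, so the intertwiner is a signed permutation matrix. *)

(** * Minors *)

Section Minors.
Variables (F : comNzRingType) (T : eqType) (x0 : T).

(** Rows and columns are indexed by lists rather than sets, so that the order of the wedge factors
    stays visible. The default [x0] is never read on lists of length [b]. *)
Definition minor (b : nat) (f : T -> T -> F) (s s' : seq T) : F :=
  \det (\matrix_(i < b, j < b) f (nth x0 s i) (nth x0 s' j)).

(** Reordering a list permutes rows or columns, and a permutation and its inverse have the same
    parity. The sign [e] is chosen before [f] and [s']: it belongs to the two orderings alone, so it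
    can later serve as a sign attached to a basis vector. *)
Lemma minor_perm (b : nat) (s s1 : seq T) : size s = b -> perm_eq s s1 ->
  exists e : bool,
    (forall f s', minor b f s s' = (-1) ^+ e * minor b f s1 s') /\
    (forall f s', minor b f s' s = (-1) ^+ e * minor b f s' s1).
Proof.
move=> sz pe.
have sz1 : size s1 = b by rewrite -(perm_size pe).
have [p Hp] : exists p : 'S_b, forall i : 'I_b, nth x0 s i = nth x0 s1 (p i).
  have /tuple_permP[p ep] : perm_eq s (Tuple (introT eqP sz1)) by [].
  exists p => i; rewrite ep (nth_map i) ?size_enum_ord //.
  by rewrite nth_ord_enum (tnth_nth x0).
exists (odd_perm p); split=> f s'.
  have -> : minor b f s s' =
    \det (row_perm p (\matrix_(i < b, j < b) f (nth x0 s1 i) (nth x0 s' j))).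
    by congr (\det _); apply/matrixP=> i j; rewrite !mxE Hp.
  by rewrite row_permE det_mulmx det_perm.
have -> : minor b f s' s =
  \det (col_perm p (\matrix_(i < b, j < b) f (nth x0 s' i) (nth x0 s1 j))).
  by congr (\det _); apply/matrixP=> i j; rewrite !mxE Hp.
by rewrite col_permE det_mulmx det_perm odd_permV mulrC.
Qed.

Lemma minor_row0 b f s s' x : x \in s -> (forall y, y \in s' -> f x y = 0) ->
  size s = b -> size s' = b -> minor b f s s' = 0.
Proof.
move=> xs fx sz sz'.
have lt_x : (index x s < b)%N by rewrite -sz index_mem.
rewrite /minor (expand_det_row _ (Ordinal lt_x)) big1 // => j _.
by rewrite !mxE /= nth_index // fx ?mul0r // mem_nth // sz'.
Qed.

Lemma minor_tr b f s s' : minor b f s s' = minor b (fun x y => f y x) s' s.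
Proof. by rewrite /minor -det_tr; congr (\det _); apply/matrixP=> i j; rewrite !mxE. Qed.

(** Listing the rows along [h] puts all the entries that may be nonzero on the diagonal. It is
    applied below with [h] the identity and with [h] a transposition. *)
Lemma minor_diag b f s (h : T -> T) : size s = b -> uniq s ->
  {in s &, forall x y, x != y -> f (h x) y = 0} ->
  minor b f (map h s) s = \prod_(x <- s) f (h x) x.
Proof.
move=> sz us f0; rewrite /minor det_trig; last first.
  apply/is_trig_mxP => i j lt_ij; rewrite !mxE (nth_map x0) ?sz //.
  by rewrite f0 ?mem_nth ?sz // nth_uniq ?sz // neq_ltn lt_ij.
rewrite (big_nth x0) sz big_mkord; apply: eq_bigr => i _.
by rewrite !mxE (nth_map x0) ?sz.
Qed.

(** Since [x] and [y] are not in [s], the matrix is block diagonal: a 2x2 block on [x], [y] and the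
    scalar matrix [q] of size [c]. *)
Lemma minor_block2 c f s x y q : size s = c ->
  uniq s -> x \notin s -> y \notin s -> 
  (forall u v, v \in s -> f u v = q * (u == v)%:R) ->
  (forall u v, u \in s -> f u v = q * (u == v)%:R) ->
  minor c.+2 f [:: x, y & s] [:: x, y & s] =
    (f x x * f y y - f x y * f y x) * q ^+ c.
Proof.
move=> sz us xs ys fr fl.
rewrite /minor.
have -> : (\matrix_(i < c.+2, j < c.+2)
   f (nth x0 [:: x, y & s] i) (nth x0 [:: x, y & s] j)) =
  block_mx (\matrix_(i < 2, j < 2) f (nth x0 [:: x; y] i) (nth x0 [:: x; y] j))
    0 0 (q%:M) :> 'M_(2 + c).
  apply/matrixP=> i j; rewrite -(splitK i) -(splitK j).
  case: (split i) => i'; case: (split j) => j' /=;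
  rewrite ?block_mxEul ?block_mxEur ?block_mxEdl ?block_mxEdr !mxE /=.
  - by case: i' => [[|[|]]] //=; case: j' => [[|[|]]].
  - have ms : nth x0 s j' \in s by rewrite mem_nth // sz.
    rewrite fr //; case: i' => [[|[|]]] //= _.
      by case: eqP xs => [->|]; rewrite ?ms ?mulr0.
    by case: eqP ys => [->|]; rewrite ?ms ?mulr0.
  - have ms : nth x0 s i' \in s by rewrite mem_nth // sz.
    rewrite fl //; case: j' => [[|[|]]] //= _.
      by case: eqP xs => [<-|]; rewrite ?ms ?mulr0.
    by case: eqP ys => [<-|]; rewrite ?ms ?mulr0.
  by rewrite !add0n fr ?mem_nth ?sz // nth_uniq ?sz // mulr_natr.
rewrite [LHS](@det_ublock _ 2 c) det_scalar; congr (_ * _).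
rewrite (expand_det_row _ ord0) big_ord_recl big_ord1 /cofactor !det_mx11 !mxE /=.
by rewrite !add0n expr0 expr1 mul1r mulN1r mulrN.
Qed.

End Minors.

(** * A generator acting on subsets, and its exterior powers *)

Section LocalOperator.
Variables (F : comNzRingType) (n : nat) (q a be : F) (m m' : 'I_n.+1).
Hypothesis adj : m' = m.+1 :> nat.
Hypothesis be2 : be ^+ 2 = a * (1 - a).

Definition set_weight (X : {set 'I_n.+1}) : F :=
  if m \in X then (if m' \in X then 1 else a)
  else (if m' \in X then 1 - a else 0).

Definition set_coupling (X : {set 'I_n.+1}) : F :=
  if (m \in X) (+) (m' \in X) then be else 0.

(** The operator $q - (1+q)E_i$ in the basis $v_X$. On singletons it becomes [point_op], the Burau
    matrix. *)
Definition set_op (X Y : {set 'I_n.+1}) : F :=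
  q * (X == Y)%:R - (1 + q) *
  ((X == Y)%:R * set_weight Y + (X == tperm m m' @: Y)%:R * set_coupling Y).

Definition point_op (x y : 'I_n.+1) : F := set_op [set x] [set y].

Let neq_mm' : m != m'.
Proof. by rewrite -val_eqE /= adj neq_ltn ltnSn. Qed.

Lemma mem_swap (X : {set 'I_n.+1}) x :
  (x \in tperm m m' @: X) = (tperm m m' x \in X).
Proof.
by rewrite -[in LHS](tpermK m m' x) mem_imset //; apply: perm_inj.
Qed.

Lemma point_opE x y : point_op x y =
  if x == y then
    (if x == m then q - (1 + q) * a else
     if x == m' then q - (1 + q) * (1 - a) else q)
  else if ((x == m) && (y == m')) || ((x == m') && (y == m)) then - (1 + q) * be
  else 0.
Proof.
rewrite /point_op /set_op /set_weight /set_coupling !inE imset_set1.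
have e1 u v : ([set u] == [set v] :> {set 'I_n.+1}) = (u == v).
  by apply/eqP/eqP => [/set1_inj|->].
rewrite !e1.
have mE : (m' == m) = false by rewrite eq_sym (negbTE neq_mm').
have mE' : (m == m') = false by rewrite (negbTE neq_mm').
have [->|nxy] := eqVneq x y.
  have [->|ny] := eqVneq y m.
    by rewrite ?eqxx tpermL ?mE ?mE' /=; ring.
  have [->|ny'] := eqVneq y m'.
    by rewrite ?eqxx tpermR ?mE ?mE' /=; ring.
  by rewrite tpermD 1?eq_sym // ?[m == y]eq_sym ?[m' == y]eq_sym ?(negbTE ny) ?(negbTE ny') ?eqxx /=; ring.
case: (tpermP m m' y) => [ey|ey|/eqP ny /eqP ny'].
- rewrite ey ?eqxx ?mE ?mE' /= ?andbF ?andbT /=.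
  by case: (x == m') => /=; ring.
- rewrite ey ?eqxx ?mE ?mE' /= ?andbF ?andbT ?orbF /=.
  by case: (x == m) => /=; ring.
by rewrite ?[m == y]eq_sym ?[m' == y]eq_sym (negbTE ny) (negbTE ny') ?andbF ?(negbTE nxy) /=; ring.
Qed.

Lemma point_op_off x y : x != m -> x != m' -> point_op x y = q * (x == y)%:R.
Proof.
move=> /negbTE nx /negbTE nx'; rewrite point_opE nx nx' /=.
by case: eqP; rewrite ?mulr1 ?mulr0.
Qed.

Lemma point_opC x y : point_op x y = point_op y x.
Proof.
rewrite !point_opE eq_sym; have [->//|_] := eqVneq y x.
by case: (x == m); case: (x == m'); case: (y == m); case: (y == m').
Qed.

Lemma sorted_enum_set (X : {set 'I_n.+1}) :
  sorted (fun x y : 'I_n.+1 => (x < y)%N) (enum X).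
Proof.
rewrite /enum_mem; apply: sorted_filter; first by move=> x y z; apply: ltn_trans.
by have := iota_ltn_sorted 0 n.+1; rewrite -val_enum_ord sorted_map -enumT.
Qed.

(* Only one of the neighbours [m], [m'] lies in [X], so exchanging them preserves the order. *)
Lemma enum_swap (X : {set 'I_n.+1}) : (m \in X) (+) (m' \in X) ->
  enum (tperm m m' @: X) = map (tperm m m') (enum X).
Proof.
move=> dX.
apply: (@irr_sorted_eq _ (fun x y : 'I_n.+1 => (x < y)%N)).
- by move=> x y z; apply: ltn_trans.
- by move=> x; rewrite /= ltnn.
- exact: sorted_enum_set.
- rewrite sorted_map; apply: (sub_in_sorted (P := mem X)); last exact: sorted_enum_set.
    move=> x y xX yX /= lxy.
    case: tpermP => [ex|ex|/eqP nx /eqP nx'];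
    case: tpermP => [ey|ey|/eqP ny /eqP ny'] //; subst;
      rewrite ?adj ?xX ?yX ?ltnn // in lxy dX *.
    + by rewrite ltn_neqAle lxy eq_sym -adj val_eqE ny'.
    + exact: ltn_trans lxy.
    + exact: ltnW.
    + by move: lxy; rewrite ltnS leq_eqVlt val_eqE (negbTE nx).
  by apply/allP=> x; rewrite mem_enum.
move=> x; rewrite mem_enum mem_swap.
by rewrite -[in RHS](tpermK m m' x) mem_map ?mem_enum //; apply: perm_inj.
Qed.

(** The (b+1)-st exterior power of the Burau generator is $q^b$ times the hook generator. Four cases
    occur: $X=Y$ containing both [m] and [m']; $X=Y$ containing at most one of them; $X$ and $Y$
    differing away from [m], [m']; and $X$ the swap of $Y$. *)
Lemma minor_set_op b (X Y : {set 'I_n.+1}) : #|X| = b.+1 -> #|Y| = b.+1 ->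
  minor ord0 b.+1 point_op (enum X) (enum Y) = q ^+ b * set_op X Y.
Proof.
move=> cX cY.
have sX : size (enum X) = b.+1 by rewrite -cardE.
have sY : size (enum Y) = b.+1 by rewrite -cardE.
have [eXY|nXY] := eqVneq X Y.
  subst Y; clear cY sY.
  have [/andP[mX mX']|nb] := boolP ((m \in X) && (m' \in X)).
    set Z := X :\ m :\ m'.
    have pe : perm_eq (enum X) [:: m, m' & enum Z].
      apply: uniq_perm; rewrite ?enum_uniq //=.
        by rewrite enum_uniq !inE !mem_enum !inE !eqxx (negbTE neq_mm').
      move=> x; rewrite !inE !mem_enum !inE.
      have [->|] := eqVneq x m; first by rewrite mX.
      by have [->|] := eqVneq x m'; first by rewrite mX'.
    have cZ : #|X| = #|Z|.+2.
      by rewrite (cardsD1 m X) mX (cardsD1 m' (X :\ m)) !inE mX' eq_sym neq_mm'.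
    have [c ec] : exists c, b = c.+1 by exists #|Z|; apply: succn_inj; rewrite -cX.
    subst b.
    have {}cZ : #|Z| = c by move: cZ; rewrite cX => -[].
    have [e [pr pc]] := minor_perm F ord0 sX pe.
    (* Moving [m] and [m'] to the front of both lists costs the same sign twice. *)
    rewrite pr pc mulrA -expr2 sqrr_sign mul1r.
    have Zne u : u \in enum Z -> (u != m) /\ (u != m').
      by rewrite mem_enum !inE => /and3P[].
    rewrite (@minor_block2 _ _ _ c _ _ _ _ q); first last.
    - by move=> u v /Zne[? ?]; rewrite point_op_off.
    - by move=> u v /Zne[? ?]; rewrite point_opC point_op_off // eq_sym.
    - by rewrite mem_enum !inE eqxx.
    - by rewrite mem_enum !inE eqxx andbF.
    - exact: enum_uniq.
    - by rewrite -cardE.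
    rewrite !point_opE /set_op /set_weight /set_coupling mX mX' !eqxx.
    rewrite (negbTE neq_mm') [m' == m]eq_sym (negbTE neq_mm') /=.
    (* By [be2] the 2x2 determinant is $q^2 - q(1+q) = -q$, which turns $q^c$ into $-q^{c+1}$; and
       [set_op X X] is $-1$ here. *)
    rewrite (_ : - (1 + q) * be * (- (1 + q) * be) = (1 + q) ^+ 2 * be ^+ 2); last by ring.
    by rewrite be2 mulr0 [q ^+ c.+1]exprS; ring.
  (* An off-diagonal entry that is not zero needs both [m] and [m'] in [X], so the minor is now
     diagonal. *)
  have -> : minor ord0 b.+1 point_op (enum X) (enum X) =
     \prod_(x in X) point_op x x.
    rewrite -[X in minor _ _ _ X _]map_id minor_diag ?enum_uniq //.
      by rewrite big_enum.
    move=> x y; rewrite !mem_enum => xX yX nxy.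
    rewrite point_opE (negbTE nxy); case: ifP => // /orP[] /andP[/eqP ex /eqP ey];
      by rewrite -ex -ey xX yX in nb.
  have prodq (Z : {set 'I_n.+1}) : m \notin Z -> m' \notin Z ->
    \prod_(x in Z) point_op x x = q ^+ #|Z|.
    move=> mZ mZ'; rewrite -prodr_const; apply: eq_bigr => x xZ.
    rewrite point_op_off ?eqxx ?mulr1 //; first by apply: contraNneq mZ => <-.
    by apply: contraNneq mZ' => <-.
  rewrite /set_op eqxx /set_weight /set_coupling.
  have [mX|mX] := boolP (m \in X).
    have mX' : m' \notin X by move: nb; rewrite mX.
    rewrite (negbTE mX') /= (big_setD1 m) //= prodq ?inE ?eqxx //; last first.
      by rewrite (negbTE mX') andbF.
    have -> : #|X :\ m| = b by move: cX; rewrite (cardsD1 m) mX => -[].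
    have -> : (X == tperm m m' @: X) = false.
      apply/negbTE; apply: contraNneq mX' => ->.
      by rewrite mem_swap tpermR.
    rewrite point_opE !eqxx mulr1n mulr0n; ring.
  have [mX'|mX'] := boolP (m' \in X).
    rewrite (big_setD1 m') //= prodq ?inE ?eqxx //; last first.
      by rewrite (negbTE mX) andbF.
    have -> : #|X :\ m'| = b by move: cX; rewrite (cardsD1 m') mX' => -[].
    have -> : (X == tperm m m' @: X) = false.
      apply/negbTE; apply: contraNneq mX => ->.
      by rewrite mem_swap tpermL.
    rewrite point_opE !eqxx [m' == m]eq_sym (negbTE neq_mm') mulr1n mulr0n; ring.
  rewrite prodq // cX exprS mulr0 /=; ring.
rewrite /set_op (negbTE nXY).
(* A point other than [m], [m'] lying in just one of the two sets gives a zero row if it is in [X],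
   and a zero column if it is in [Y]. *)
case: (pickP (fun x => [&& (x \in X) != (x \in Y), x != m & x != m'])).
  move=> x /and3P[xXY xm xm'].
  have -> : (X == tperm m m' @: Y) = false.
    apply/negbTE; apply: contraNneq xXY => ->.
    by rewrite mem_swap tpermD // eq_sym.
  have -> : minor ord0 b.+1 point_op (enum X) (enum Y) = 0; last by rewrite mulr0n; ring.
  have [xX|xX] := boolP (x \in X).
    apply: (@minor_row0 _ _ _ _ _ _ _ x) => //; first by rewrite mem_enum.
    move=> y; rewrite mem_enum => yY; rewrite point_op_off //.
    have /negbTE-> : x != y by apply: contraNneq xXY => e; rewrite xX e yY.
    by rewrite mulr0.
  rewrite minor_tr; apply: (@minor_row0 _ _ _ _ _ _ _ x) => //.
    by rewrite mem_enum; move: xXY; rewrite (negbTE xX); case: (x \in Y).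
  move=> y; rewrite mem_enum => yX; rewrite point_opC point_op_off //.
  by case: eqP xX => [->|]; rewrite ?mulr0 // yX.
move=> agree.
have {}agree x : x != m -> x != m' -> (x \in X) = (x \in Y).
  by move=> xm xm'; move: (agree x); rewrite xm xm' !andbT => /negbFE/eqP.
have eD : X :\ m :\ m' = Y :\ m :\ m'.
  apply/setP => x; rewrite !inE; have [//|xm'] := eqVneq x m'.
  by have [//|xm] := eqVneq x m; rewrite /= agree.
have cXY : ((m \in X) + (m' \in X) = (m \in Y) + (m' \in Y))%N.
  move: (etrans cX (esym cY)).
  rewrite (cardsD1 m X) (cardsD1 m' (X :\ m)) (cardsD1 m Y) (cardsD1 m' (Y :\ m)).
  rewrite eD !inE [m' == m]eq_sym neq_mm' /= !addnA.
  by move/addIn.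
(* Equal cardinality and agreement elsewhere leave one way to differ: each set contains exactly one
   of [m], [m'], and not the same one. *)
have [eXm eXm' dY] : [/\ (m \in X) = (m' \in Y), (m' \in X) = (m \in Y)
    & (m \in Y) (+) (m' \in Y)].
  have : ((m \in X) != (m \in Y)) || ((m' \in X) != (m' \in Y)).
    apply: contraNT nXY; rewrite negb_or !negbK => /andP[/eqP e1 /eqP e2].
    apply/eqP/setP => x; have [->//|xm] := eqVneq x m.
    by have [->//|xm'] := eqVneq x m'; apply: agree.
  by move: cXY; do 4!case: (_ \in _).
have eX : X = tperm m m' @: Y.
  apply/setP => x; rewrite mem_swap; case: tpermP => [->|->|/eqP xm /eqP xm'] //.
  exact: agree.
(* The swap preserves the increasing order, so no sign appears and the minor is diagonal along the
   transposition. *)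
rewrite eX eqxx enum_swap // minor_diag ?enum_uniq //; last first.
  move=> x y; rewrite !mem_enum => xY yY nxy.
  case: tpermP => [ex|ex|/eqP xm /eqP xm'].
  - have ym : y != m by rewrite -ex eq_sym.
    have ym' : y != m' by apply: contraTneq dY => <-; rewrite yY -ex xY.
    by rewrite point_opC point_op_off // (negbTE ym') mulr0.
  - have ym' : y != m' by rewrite -ex eq_sym.
    have ym : y != m by apply: contraTneq dY => <-; rewrite yY -ex xY.
    by rewrite point_opC point_op_off // (negbTE ym) mulr0.
  by rewrite point_op_off // (negbTE nxy) mulr0.
rewrite big_enum /=.
(* [z] is the one of [m], [m'] that lies in [Y]; it contributes the off-diagonal entry, and each of
   the other [b] points contributes [q]. *)
have [z [zY ez ezE]] : exists z, [/\ z \in Y, forall x, x \in Y -> x != z -> x != m /\ x != m'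
    & point_op (tperm m m' z) z = - (1 + q) * be].
  have [mY|mY] := boolP (m \in Y).
    have mY' : m' \notin Y by move: dY; rewrite mY.
    exists m; split=> // [x xY xm|]; first by split=> //; apply: contraNneq mY' => <-.
    by rewrite tpermL point_opE !eqxx [m' == m]eq_sym (negbTE neq_mm') orbT.
  have mY' : m' \in Y by move: dY; rewrite (negbTE mY).
  exists m'; split=> // [x xY xm|]; first by split=> //; apply: contraNneq mY => <-.
  by rewrite tpermR point_opE !eqxx (negbTE neq_mm').
rewrite (big_setD1 z) //= ezE (eq_bigr (fun=> q)); last first.
  move=> x; rewrite !inE => /andP[xz xY]; have [xm xm'] := ez x xY xz.
  by rewrite tpermD 1?eq_sym // point_op_off // eqxx mulr1.
rewrite prodr_const; have -> : #|Y :\ z| = b by move: cY; rewrite (cardsD1 z) zY => -[].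
rewrite /set_coupling dY mulr1n mulr0n; ring.
Qed.

End LocalOperator.

(** * Standard tableaux of hook shape *)

Section HookTableaux.
Variables (k N : nat).
Implicit Types (X : {set 'I_N.+1}) (t : filling k.+1 N).
Local Open Scope nat_scope.

Definition legs t : {set 'I_N.+1} := [set m | (t m).1 != 0 :> nat].

(** The entries of [X] go down the first column in increasing order, starting below the corner
    (hence the successor); the others fill the first row, corner included. *)
Definition hook_filling X : filling k.+1 N :=
  [ffun m => if m \in X then (inord (index m (enum X)).+1, ord0)
             else (ord0, inord (index m (enum (~: X))))].

(** The bound on the cardinality keeps the row number inside ['I_k.+1], so that [inord] does not
    fall back on its default. *)
Lemma hook_filling_in X m : #|X| <= k -> m \in X ->
  (hook_filling X m).1 = (index m (enum X)).+1 :> nat /\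
  (hook_filling X m).2 = 0 :> nat.
Proof.
move=> cX mX; rewrite ffunE mX /= inordK // ltnS (leq_trans _ cX) //.
by rewrite cardE index_mem mem_enum.
Qed.

Lemma hook_filling_out X m : m \notin X ->
  (hook_filling X m).1 = 0 :> nat /\
  (hook_filling X m).2 = index m (enum (~: X)) :> nat.
Proof.
move=> mX; rewrite ffunE (negbTE mX) /= inordK //.
have : index m (enum (~: X)) < #|~: X| by rewrite cardE index_mem mem_enum inE.
by move/leq_trans; apply; rewrite -[X in _ <= X]card_ord max_card.
Qed.

Lemma legs_hook_filling X : #|X| <= k -> legs (hook_filling X) = X.
Proof.
move=> cX; apply/setP=> m; rewrite inE.
have [mX|mX] := boolP (m \in X); first by have [-> _] := hook_filling_in cX mX.
by have [-> _] := hook_filling_out mX.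
Qed.

Let ltn_ord_tr : transitive (fun x y : 'I_N.+1 => x < y).
Proof. by move=> x y z; apply: ltn_trans. Qed.

Lemma index_enum_lt X (x y : 'I_N.+1) : x \in X -> y \in X ->
  index x (enum X) < index y (enum X) -> x < y.
Proof.
move=> xX yX.
by apply: (sorted_ltn_index ltn_ord_tr (sorted_enum_set X)); rewrite mem_enum.
Qed.

Lemma nth_hook a b j : nth 0 (hook a b) j =
  if j == 0 then a.+1 else (j <= b : nat).
Proof. by case: j => [|j] //=; rewrite nth_nseq; case: ltnP. Qed.

(** Both arms increase by construction; the condition on [ord0] puts the least entry in the corner,
    which makes the first column increase from its top box. *)
Lemma std_hook_filling a b X : a + b = N -> b <= k -> ord0 \notin X -> #|X| = b ->
  std_tableau (hook a b) (hook_filling X).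
Proof.
move=> eN lbk X0 cX.
have cXk : #|X| <= k by rewrite cX.
have cXC : #|~: X| = a.+1 by have := cardsC X; rewrite cX card_ord; lia.
have hin m := @hook_filling_in X m cXk.
have hout := @hook_filling_out X.
apply/and5P; split.
- by rewrite /= sumn_nseq mul1n -eN addSn.
- apply/injectiveP => m m' e.
  have [mX|mX] := boolP (m \in X); have [mX'|mX'] := boolP (m' \in X).
  + apply: (@index_inj _ ord0 (enum X)); rewrite ?mem_enum //.
    by apply: succn_inj; rewrite -(hin m mX).1 -(hin m' mX').1 e.
  + by have := (hin m mX).1; rewrite e (hout m' mX').1.
  + by have := (hin m' mX').1; rewrite -e (hout m mX).1.
  apply: (@index_inj _ ord0 (enum (~: X))); rewrite ?mem_enum ?inE //.
  by rewrite -(hout m mX).2 -(hout m' mX').2 e.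
- apply/forallP => -[p c] /=; apply/eqP; apply/idP/idP.
    case/codomP => m e; have {e} [-> ->] : p = (hook_filling X m).1 /\ c = (hook_filling X m).2.
      by rewrite -e.
    rewrite nth_hook; have [mX|mX] := boolP (m \in X).
      have [-> ->] := hin m mX; rewrite /=.
      by rewrite -cX cardE index_mem mem_enum mX.
    have [-> ->] := hout m mX; rewrite eqxx.
    by rewrite -cXC cardE index_mem mem_enum inE.
  (* The box in column [c] of the first row holds the [c]-th element of the complement; the box in
     row [p > 0] holds element [p.-1] of [X]. *)
  rewrite nth_hook; case: eqP => [p0|/eqP p0] lc.
    have szC : c < size (enum (~: X)) by rewrite -cardE cXC.
    have mX : nth ord0 (enum (~: X)) c \notin X.
      by have := mem_nth ord0 szC; rewrite mem_enum inE.
    apply/codomP; exists (nth ord0 (enum (~: X)) c).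
    have [e1 e2] := hout _ mX.
    rewrite [hook_filling _ _]surjective_pairing; congr (_, _); apply: val_inj; rewrite /= ?e1 ?e2 //.
    by rewrite index_uniq ?enum_uniq.
  have [pb c0] : p <= b /\ c = 0 :> nat by case: (p <= b) lc => //=; lia.
  have sz : p.-1 < size (enum X) by rewrite -cardE cX prednK // lt0n.
  have mX : nth ord0 (enum X) p.-1 \in X.
    by have := mem_nth ord0 sz; rewrite mem_enum.
  apply/codomP; exists (nth ord0 (enum X) p.-1).
  have [e1 e2] := hin _ mX.
  rewrite [hook_filling _ _]surjective_pairing; congr (_, _); apply: val_inj; rewrite /= ?e1 ?e2 //.
  by rewrite index_uniq ?enum_uniq // prednK // lt0n.
- apply/forallP=> m; apply/forallP=> m'; apply/implyP; rewrite -val_eqE /=.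
  have [mX|mX] := boolP (m \in X); have [mX'|mX'] := boolP (m' \in X).
  + by rewrite (hin m mX).2 (hin m' mX').2 andbF.
  + by rewrite (hin m mX).1 (hout m' mX').1.
  + by rewrite (hout m mX).1 (hin m' mX').1.
  rewrite (hout m mX).2 (hout m' mX').2 => /andP[_].
  by apply: index_enum_lt; rewrite inE.
apply/forallP=> m; apply/forallP=> m'; apply/implyP; rewrite -val_eqE /=.
have [mX|mX] := boolP (m \in X); have [mX'|mX'] := boolP (m' \in X).
+ rewrite (hin m mX).1 (hin m' mX').1 => /andP[_]; rewrite ltnS.
  exact: index_enum_lt.
+ by rewrite (hout m' mX').1 ltn0 andbF.
(* An arm entry sharing a column with a leg entry is in the corner, so it is the first element of
   the complement, namely 0. *)
+ rewrite (hout m mX).2 (hin m' mX').2 => /andP[/eqP m0 _].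
  have m_eq0 : m = ord0.
    have X0' : ord0 \in ~: X by rewrite inE.
    have mXC : m \in ~: X by rewrite inE.
    have := @index_enum_lt (~: X) m ord0 mXC X0'; rewrite m0 ltn0 lt0n.
    case: eqP => [i0 _|_ /(_ isT)//].
    by apply: (@index_inj _ ord0 (enum (~: X))); rewrite ?mem_enum // m0 i0.
  by rewrite m_eq0 lt0n; apply: contraNneq X0 => e; rewrite (_ : ord0 = m') //; apply: val_inj.
by rewrite (hout m' mX').1 ltn0 andbF.
Qed.

Section StdHook.
Variables (a b : nat) (t : filling k.+1 N).
Hypotheses (lbk : b <= k) (st : std_tableau (hook a b) t).

Lemma std_hook_eqN : a + b = N.
Proof. by case/and5P: st => /eqP /=; rewrite sumn_nseq mul1n addSn => -[]. Qed.

Lemma std_hook_inj : injective t.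
Proof. by case/and5P: st => _ /injectiveP. Qed.

Lemma std_hook_shape (x : 'I_k.+1 * 'I_N.+1) :
  (x \in codom t) = (x.2 < nth 0 (hook a b) x.1).
Proof. by case/and5P: st => _ _ /forallP/(_ x)/eqP. Qed.

Lemma std_hook_row m m' : (t m).1 = (t m').1 -> (t m).2 < (t m').2 -> m < m'.
Proof.
case/and5P: st => _ _ _ /forallP/(_ m)/forallP/(_ m')/implyP h _ e l.
by apply: h; rewrite e eqxx.
Qed.

Lemma std_hook_col m m' : (t m).2 = (t m').2 -> (t m).1 < (t m').1 -> m < m'.
Proof.
case/and5P: st => _ _ _ _ /forallP/(_ m)/forallP/(_ m')/implyP h e l.
by apply: h; rewrite e eqxx.
Qed.

Lemma std_hook_leg m : m \in legs t -> (t m).1 <= b /\ (t m).2 = ord0.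
Proof.
rewrite inE => m0; have := std_hook_shape (t m); rewrite codom_f nth_hook (negbTE m0).
case: ((t m).1 <= b) => /esym lc; last by rewrite ltn0 in lc.
by split=> //; apply: val_inj => /=; move: lc; case: (nat_of_ord _).
Qed.

Lemma std_hook_arm m : m \notin legs t -> (t m).1 = ord0 /\ (t m).2 <= a.
Proof.
rewrite inE negbK => /eqP m0; have := std_hook_shape (t m); rewrite codom_f nth_hook m0 /=.
by rewrite ltnS => <-; split=> //; apply: val_inj.
Qed.

(** Both lists are strictly increasing and have the same members. Hence the leg entries, read in
    order, occupy rows 1 to [b], with nothing left to choose. *)
Lemma std_hook_rows : [seq nat_of_ord (t m).1 | m <- enum (legs t)] = iota 1 b.
Proof.
apply: (irr_sorted_eq ltn_trans ltnn).
- rewrite sorted_map; apply: (sub_in_sorted (P := mem (legs t))); last exact: sorted_enum_set.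
    move=> x y xX yX /= lxy.
    have [_ ex] := std_hook_leg xX; have [_ ey] := std_hook_leg yX.
    rewrite ltnNge leq_eqVlt; apply/negP => /orP[/eqP e|l].
      have e' : y = x by apply: std_hook_inj; rewrite [t y]surjective_pairing [t x]surjective_pairing ex ey; congr (_, _); apply: val_inj.
      by rewrite e' ltnn in lxy.
    have : y < x by apply: std_hook_col l; rewrite ex ey.
    by rewrite ltnNge ltnW.
  by apply/allP=> x; rewrite mem_enum.
- exact: iota_ltn_sorted.
move=> p; rewrite mem_iota add1n ltnS; apply/mapP/andP => [[m]|[p1 pb]].
  rewrite mem_enum => mX ->; have [? _] := std_hook_leg mX; split=> //.
  by move: mX; rewrite inE lt0n.
have pk : p < k.+1 by rewrite ltnS (leq_trans pb).
have : (Ordinal pk, ord0 : 'I_N.+1) \in codom t.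
  by rewrite std_hook_shape nth_hook /= pb; case: (p) p1.
case/codomP => m e; exists m; last by rewrite -e.
by rewrite mem_enum inE -e /= -lt0n.
Qed.

Lemma std_hook_cols : [seq nat_of_ord (t m).2 | m <- enum (~: legs t)] = iota 0 a.+1.
Proof.
apply: (irr_sorted_eq ltn_trans ltnn).
- rewrite sorted_map; apply: (sub_in_sorted (P := mem (~: legs t))); last exact: sorted_enum_set.
    move=> x y /=; rewrite !in_setC => xX yX lxy.
    have [ex _] := std_hook_arm xX; have [ey _] := std_hook_arm yX.
    rewrite ltnNge leq_eqVlt; apply/negP => /orP[/eqP e|l].
      have e' : y = x by apply: std_hook_inj; rewrite [t y]surjective_pairing [t x]surjective_pairing ex ey; congr (_, _); apply: val_inj.
      by rewrite e' ltnn in lxy.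
    have : y < x by apply: std_hook_row l; rewrite ex ey.
    by rewrite ltnNge ltnW.
  by apply/allP=> x; rewrite mem_enum.
- exact: iota_ltn_sorted.
move=> p; rewrite mem_iota add0n ltnS; apply/mapP/andP => [[m]|[_ pa]].
  by rewrite mem_enum in_setC => mX ->; have [_ ?] := std_hook_arm mX.
have pN : p < N.+1 by have := std_hook_eqN; lia.
have : (ord0 : 'I_k.+1, Ordinal pN) \in codom t.
  by rewrite std_hook_shape.
case/codomP => m e; exists m; last by rewrite -e.
by rewrite mem_enum !inE -e.
Qed.

Lemma card_legs : #|legs t| = b.
Proof. by rewrite cardE -(size_map (fun m => nat_of_ord (t m).1)) std_hook_rows size_iota. Qed.

(** If 0 were in the leg, the corner above it would hold a smaller entry. *)
Lemma legs0 : ord0 \notin legs t.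
Proof.
apply/negP => h; have [_ e2] := std_hook_leg h.
have : (ord0 : 'I_k.+1, ord0 : 'I_N.+1) \in codom t by rewrite std_hook_shape.
case/codomP => m e; have := @std_hook_col m ord0; rewrite -e e2 ltn0 /= => /(_ erefl).
by move: h; rewrite inE lt0n => -> /(_ isT).
Qed.

Lemma std_hookE : t = hook_filling (legs t).
Proof.
apply/ffunP => m; rewrite [t m]surjective_pairing ffunE; case: ifPn => mX.
  have [_ ->] := std_hook_leg mX; congr (_, _); apply: val_inj => /=.
  have lt_i : index m (enum (legs t)) < size (enum (legs t)) by rewrite index_mem mem_enum.
  have <- : nth 0 [seq nat_of_ord (t m).1 | m <- enum (legs t)] (index m (enum (legs t))) = (t m).1.
    by rewrite (nth_map ord0) // nth_index // mem_enum.
  rewrite -cardE card_legs in lt_i.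
  by rewrite std_hook_rows nth_iota // add1n /= inordK // ltnS (leq_trans lt_i).
have [-> _] := std_hook_arm mX; congr (_, _); apply: val_inj => /=.
have lt_i : index m (enum (~: legs t)) < size (enum (~: legs t)).
  by rewrite index_mem mem_enum inE.
have <- : nth 0 [seq nat_of_ord (t m).2 | m <- enum (~: legs t)] (index m (enum (~: legs t))) = (t m).2.
  by rewrite (nth_map ord0) // nth_index // mem_enum inE.
rewrite -(size_map (fun m => nat_of_ord (t m).2)) std_hook_cols size_iota in lt_i.
by rewrite std_hook_cols nth_iota // add0n /= inordK // (leq_trans lt_i) // ltnS -std_hook_eqN leq_addr.
Qed.

(** Each truncation is again a hook (or empty) whose first row has at most [a.+1] boxes, so the
    difference between its first and last rows stays within [r - k.+1]. *)
Lemma adm_std_hook r : k.+2 <= r -> a.+1 <= r - k.+1 -> adm_tableau r t.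
Proof.
move=> lkr lar; apply/allP => i _.
set f := fun j => #|[set m : 'I_N.+1 | (m < N.+1 - i) && ((t m).1 == j :> nat)]|.
have -> : trunc_shape t i = map f (iota 0 k.+1) by [].
(* A row below the first has at most one box. If the box of row [j'] survives the truncation, so
   does the box of row [j] in the same column, whose entry is smaller. *)
have mono j j' : j < j' -> j' <= k -> f j' <= f j.
  move=> ljj' lj'; rewrite {1}/f; set S := [set _ | _].
  have [->|[m mS]] := set_0Vmem S; first by rewrite cards0.
  have -> : #|S| = 1.
    apply/eqP/cards1P; exists m; apply/setP => x; rewrite !inE.
    move: mS; rewrite !inE => /andP[mi /eqP mj].
    apply/andP/eqP => [[xi /eqP xj]|->]; last by rewrite mi mj.
    apply: std_hook_inj; rewrite [t m]surjective_pairing [t x]surjective_pairing.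
    congr (_, _); first by apply: val_inj; rewrite /= mj xj.
    have [_ ->] : (t m).1 <= b /\ (t m).2 = ord0 by apply: std_hook_leg; rewrite inE mj; lia.
    by have [_ ->] : (t x).1 <= b /\ (t x).2 = ord0 by apply: std_hook_leg; rewrite inE xj; lia.
  move: mS; rewrite !inE => /andP[mi /eqP mj].
  have [mb m2] : (t m).1 <= b /\ (t m).2 = ord0 by apply: std_hook_leg; rewrite inE mj; lia.
  have lj : j < k.+1 by lia.
  have : (Ordinal lj, ord0 : 'I_N.+1) \in codom t.
    rewrite std_hook_shape nth_hook /=; case: eqP => // _.
    by rewrite (_ : j <= b) //; lia.
  case/codomP => m' e; rewrite card_gt0; apply/set0Pn; exists m'.
  rewrite inE -e /= eqxx andbT; apply: leq_trans mi; rewrite ltnS ltnW //.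
  by apply: std_hook_col; rewrite -e ?m2 //= mj.
rewrite /admissible lkr /=; apply/andP; split.
  apply/andP; split; last by rewrite drop_oversize //= size_map size_iota.
  rewrite -[f 0 :: _]/(map f (iota 0 k.+1)) sorted_map.
  apply: (sub_in_sorted (P := fun j => j <= k)); last exact: (iota_ltn_sorted 0 k.+1).
    by move=> x y _ /= yk lxy; apply: mono.
  by apply/allP => x; rewrite mem_iota add0n ltnS.
apply: leq_trans lar; apply: leq_trans (leq_subr _ _) _.
have -> : a.+1 = #|~: legs t|.
  by rewrite cardE -(size_map (fun m => nat_of_ord (t m).2)) std_hook_cols size_iota.
by apply/subset_leq_card/subsetP => m; rewrite !inE negbK => /andP[].
Qed.

End StdHook.
End HookTableaux.

(** Having at most [k] rows forces [b < k]. If the last of the [k] rows is empty, the bound on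
    [a.+1] is admissibility itself; if it has a box, then [b = k'] and the bound comes from
    [a + b < r - 1]. *)
Lemma admissible_hook k r a b : (a + b < r - 1)%N -> (1 <= b)%N ->
  admissible k r (hook a b) ->
  exists k', [/\ k = k'.+1, (b <= k')%N, (k'.+2 <= r)%N & (a.+1 <= r - k'.+1)%N].
Proof.
move=> lab b1; rewrite /admissible /young => /and3P[lkr /andP[_ al]].
case: k lkr al => [|k] lkr /= al; first by [].
have lbk : (b <= k)%N.
  rewrite drop_nseq all_nseq /= orbF in al; lia.
move=> h; exists k; split=> //.
by move: h; case: k lbk lkr {al} => [|k] lbk lkr /=; rewrite ?nth_nseq; case: ltnP; lia.
Qed.

(** * Axial distances in hook tableaux *)

Section Contents.
Variable N : nat.
Implicit Types X : {set 'I_N.+1}.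
Local Open Scope nat_scope.

Definition count_below X (p : nat) := #|[set y in X | y < p]|.

Lemma count_belowS X (m : 'I_N.+1) :
  count_below X m.+1 = count_below X m + (m \in X).
Proof.
rewrite /count_below (cardsD1 m) !inE ltnSn andbT addnC; congr (_ + _).
by apply: eq_card => y; rewrite !inE ltnS [y <= m]leq_eqVlt val_eqE; case: eqVneq => [->|]; rewrite ?ltnn ?andbF.
Qed.

Lemma count_belowC X p : p <= N.+1 -> count_below X p + count_below (~: X) p = p.
Proof.
elim: p => [|p IH] lp.
  by rewrite /count_below !eq_card0 // => y; rewrite !inE andbF.
rewrite -[p]/(nat_of_ord (Ordinal lp)) !count_belowS inE /=.
by have := IH (ltnW lp); case: (_ \in X) => /=; lia.
Qed.

Lemma index_enum_count X (m : 'I_N.+1) : m \in X -> index m (enum X) = count_below X m.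
Proof.
move=> mX.
have -> : count_below X m = count (fun y : 'I_N.+1 => y < m) (enum X).
  rewrite -sum1_count big_enum_cond /= /count_below -sum1_card; apply: eq_bigl => y.
  by rewrite !inE.
have : m \in enum X by rewrite mem_enum.
elim: (enum X) (sorted_enum_set X) => //= x s IH ps; rewrite inE eq_sym.
have ltx y : y \in s -> x < y.
  have tr : transitive (fun x y : 'I_N.+1 => x < y) by move=> u v w; apply: ltn_trans.
  by move: y; apply/allP; apply: order_path_min ps.
have [xm _|nxm /= ms] := eqVneq x m.
  rewrite xm ltnn add0n; apply/esym/eqP; rewrite -leqn0 leqNgt -has_count.
  by apply/hasPn => y /ltx; rewrite xm -leqNgt; apply: ltnW.
by rewrite ltx // add1n IH ?(path_sorted ps).
Qed.

(** For [p != m'], either both or neither of [m], [m'] lie below [p]. *)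
Lemma count_below_swap X (m m' : 'I_N.+1) (p : nat) : m' = m.+1 :> nat -> p != m' ->
  count_below (tperm m m' @: X) p = count_below X p.
Proof.
move=> adj pm'; rewrite /count_below.
have -> : [set y in tperm m m' @: X | y < p] = tperm m m' @: [set y in X | y < p].
  apply/setP=> y; rewrite mem_swap !inE mem_swap; congr (_ && _).
  by case: tpermP => [->|->|//]; rewrite adj in pm' *; apply/idP/idP; lia.
by rewrite card_imset //; apply: perm_inj.
Qed.

Section Filling.
Variables (k : nat) (X : {set 'I_N.+1}) (m m' : 'I_N.+1).
Hypotheses (cX : #|X| <= k) (adj : m' = m.+1 :> nat).

(** Contents are positions in [X] or in its complement, up to sign and a shift by one. In the mixed
    cases the two positions count all entries below [m], so their sum is [m] and the distance does
    not depend on the rest of [X]. *)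
Lemma dcont_hook_filling : dcont (hook_filling k X) m m' =
  (if m \in X then (if m' \in X then 1 else - (m.+1%:Z))
  else (if m' \in X then m.+1%:Z else - 1))%R.
Proof.
have cS := count_belowS X m; have cSC := count_belowS (~: X) m.
have cC := count_belowC X (ltnW (ltn_ord m)).
have hin x := @hook_filling_in k N X x cX.
have hout := @hook_filling_out k N X.
rewrite /dcont; move: cS cSC; rewrite -adj !inE.
have [mX|mX] := boolP (m \in X); have [mX'|mX'] := boolP (m' \in X) => cS cSC.
- have [-> ->] := hin m mX; have [-> ->] := hin m' mX'.
  rewrite !index_enum_count //; lia.
- have [-> ->] := hin m mX; have [-> ->] := hout m' mX'.
  rewrite !index_enum_count ?inE //; lia.
- have [-> ->] := hout m mX; have [-> ->] := hin m' mX'.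
  rewrite !index_enum_count ?inE //; lia.
have [-> ->] := hout m mX; have [-> ->] := hout m' mX'.
rewrite !index_enum_count ?inE //; lia.
Qed.

(** Exchanging consecutive entries between leg and arm changes no relative order inside either of
    them, so every other entry keeps its box. *)
Lemma hook_filling_swap : (m \in X) (+) (m' \in X) ->
  hook_filling k (tperm m m' @: X) = [ffun x => hook_filling k X (tperm m m' x)].
Proof.
move=> dX; set X' := tperm m m' @: X.
have eC : ~: X' = tperm m m' @: (~: X).
  by apply/setP=> y; rewrite inE !mem_swap inE.
have m_m' : m != m' by rewrite -val_eqE /= adj neq_ltn ltnSn.
have cSX := count_belowS X m; have cSCX := count_belowS (~: X) m.
have cS := count_belowS X' m; have cSC := count_belowS (~: X') m.
rewrite -adj !inE mem_swap tpermL in cS cSC cSX cSCX.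
have sw (p : nat) : p != m' -> count_below X' p = count_below X p.
  by move=> ?; apply: count_below_swap.
have swC (p : nat) : p != m' -> count_below (~: X') p = count_below (~: X) p.
  by move=> ?; rewrite eC; apply: count_below_swap.
have e1 : count_below X' m = count_below X m by rewrite sw ?val_eqE.
have e2 : count_below (~: X') m = count_below (~: X) m by rewrite swC ?val_eqE.
have hE (Y : {set 'I_N.+1}) x : hook_filling k Y x =
   if x \in Y then (inord (count_below Y x).+1, ord0) else (ord0, inord (count_below (~: Y) x)).
  by rewrite ffunE; case: ifPn => xY; rewrite index_enum_count ?inE.
apply/ffunP => x; rewrite [RHS]ffunE !hE mem_swap.
case: tpermP => [->|->|/eqP xm /eqP xm'].
- move: dX; have [mX|mX] := boolP (m \in X); have [mX'|mX'] := boolP (m' \in X) => //= _.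
    by congr (_, inord _); rewrite e2 cSCX mX addn0.
  by congr (inord _.+1, _); rewrite e1 cSX (negbTE mX) addn0.
- move: dX; have [mX|mX] := boolP (m \in X); have [mX'|mX'] := boolP (m' \in X) => //= _.
    by congr (inord _.+1, _); rewrite -e1 cS (negbTE mX') addn0.
  by congr (_, inord _); rewrite -e2 cSC mX' addn0.
by rewrite sw ?swC ?val_eqE.
Qed.

End Filling.
End Contents.

(** * Quantum integers *)

Section QuantumIntegers.
Variables (R : realType) (r : nat) (sgn : bool).
Hypothesis r3 : (3 <= r)%N.
Local Notation C := (R[i]).
Local Notation z := (qhalf R r sgn).

(** De Moivre's formula. *)
Lemma qhalfX m : z ^+ m = Complex (cos (m%:R * (pi / r%:R)))
   ((if sgn then 1 else -1) * sin (m%:R * (pi / r%:R))).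
Proof.
elim: m => [|m IH]; first by rewrite !mul0r cos0 sin0 mulr0 expr0.
rewrite exprS IH /qhalf; set th := pi / r%:R.
have -> : m.+1%:R * th = th + m%:R * th by rewrite -natr1 mulrDl mul1r addrC.
rewrite cosD sinD.
apply/eqP; rewrite eq_complex /=; apply/andP; split; apply/eqP; case: (sgn); ring.
Qed.

Lemma qhalf_normX m : z ^+ m * Complex (cos (m%:R * (pi / r%:R)))
   (- ((if sgn then 1 else -1) * sin (m%:R * (pi / r%:R)))) = 1.
Proof.
rewrite qhalfX; apply/eqP; rewrite eq_complex /=; apply/andP; split; apply/eqP.
  rewrite -[RHS](cos2Dsin2 (m%:R * (pi / r%:R) : R)).
  case: (sgn); ring.
by case: (sgn); ring.
Qed.

Lemma qhalf_neq0 : z != 0.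
Proof.
have := qhalf_normX 1; rewrite expr1 => h; apply/eqP => e.
by move: h; rewrite e mul0r => /eqP; rewrite eq_sym oner_eq0.
Qed.

Lemma normr_qhalf : `|z| = 1.
Proof.
have h : `|z| ^+ 2 = 1.
  rewrite sqr_normc -[RHS](qhalf_normX 1) expr1; congr (_ * _).
  by rewrite /qhalf /= mul1r.
by move/eqP: h; rewrite sqrp_eq1 // => /eqP.
Qed.

(** The difference is $\pm 2i\sin(m\pi/r)$, and $0 < m\pi/r < \pi$. *)
Lemma qhalf_sub_neq0 m : (0 < m < r)%N -> z ^+ m - z ^- m != 0.
Proof.
move=> /andP[m0 mr].
have -> : z ^- m = Complex (cos (m%:R * (pi / r%:R)))
   (- ((if sgn then 1 else -1) * sin (m%:R * (pi / r%:R)))).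
  have zu : z ^+ m \is a GRing.unit by rewrite unitfE expf_neq0 // qhalf_neq0.
  by apply: (mulrI zu); rewrite divrr // qhalf_normX.
rewrite qhalfX eq_complex /= subrr eqxx /= opprK.
have r0 : 0 < r%:R :> R by rewrite ltr0n; apply: leq_trans r3.
have r_gt0 : (0 < r)%N by apply: leq_trans r3.
have : 0 < sin (m%:R * (pi / r%:R) : R).
  apply: sin_gt0_pi; rewrite mulr_gt0 ?divr_gt0 ?pi_gt0 ?ltr0n //=.
  rewrite mulrCA gtr_pMr ?pi_gt0 // ltr_pdivrMr // mul1r ltr_nat //.
case: (sgn) => s0; rewrite -mulr2n mulrn_eq0 /= ?mul1r ?mulN1r ?oppr_eq0; exact: lt0r_neq0.
Qed.

Lemma qint_nat_neq0 m : (0 < m < r)%N -> qint z m%:Z != 0.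
Proof.
move=> mr; rewrite /qint -exprnN mulf_neq0 ?invr_eq0 //.
  by rewrite -exprnP qhalf_sub_neq0.
by have := @qhalf_sub_neq0 1; rewrite expr1; apply; rewrite (leq_trans _ r3).
Qed.

Lemma qintN (y : C) m : qint y (- m) = - qint y m.
Proof. by rewrite /qint opprK -mulNr opprB. Qed.

Lemma qint0 (y : C) : qint y 0 = 0.
Proof. by rewrite /qint oppr0 subrr mul0r. Qed.

Lemma qint1 : qint z 1 = 1.
Proof.
by rewrite /qint divff //; have := @qhalf_sub_neq0 1; rewrite expr1; apply; rewrite (leq_trans _ r3).
Qed.

Lemma qint_rec d : qint z (d + 1) + qint z (d - 1) = qint z 2 * qint z d.
Proof.
have z0 := qhalf_neq0.
have dz : z - z ^-1 != 0.
  by have := @qhalf_sub_neq0 1; rewrite expr1; apply; rewrite (leq_trans _ r3).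
have w0 : z ^ d != 0 by rewrite expfz_neq0.
have e1 : z ^ (d + 1) = z ^ d * z by rewrite expfzDr // expr1z.
have e2 : z ^ (d - 1) = z ^ d / z by rewrite expfzDr // -invr_expz expr1z.
rewrite /qint -![z ^ (- _)]invr_expz e1 e2.
field.
rewrite z0 w0 andbT /= (_ : z * z - 1 = z * (z - z^-1)) ?mulf_neq0 //.
by rewrite mulrBr divff.
Qed.

(** The coefficient $\alpha_{t,i}$ as a function of the axial distance alone. *)
Definition qproj (d : int) : C := qint z (d + 1) / (qint z 2 * qint z d).

Lemma qproj1 : qproj 1 = 1.
Proof. by rewrite /qproj qint1 mulr1 divff // (qint_nat_neq0 (m := 2)). Qed.

Lemma qprojN1 : qproj (- 1) = 0.
Proof. by rewrite /qproj addNr qint0 mul0r. Qed.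

(** Quantum integers are odd, so $\alpha(-m) = [m-1]/([2][m])$, and $[m+1]+[m-1]=[2][m]$ makes
    $\alpha(m)$ and $\alpha(-m)$ add up to 1. *)
Lemma qprojN m : (0 < m < r)%N -> 1 - qproj (- m%:Z) = qproj m%:Z.
Proof.
move=> mr; have m0 := qint_nat_neq0 mr; have q2 := @qint_nat_neq0 2 r3.
rewrite /qproj (_ : - m%:Z + 1 = - (m%:Z - 1)); last by rewrite opprB addrC.
rewrite !qintN mulrN invrN mulrNN.
apply/eqP; rewrite subr_eq -mulrDl qint_rec divff // mulf_neq0 //.
Qed.

End QuantumIntegers.

(** * The equivalence *)

Section SignedBijection.
Variables (R : realType) (N : nat) (T1 T2 : finType).
Variables (A : 'I_N -> op R T1 T1) (B : 'I_N -> op R T2 T2).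
Variables (g : T2 -> T1) (g' : T1 -> T2) (e : T2 -> bool).

(** The intertwiner is the signed permutation matrix of [g] and [e]; its inverse is its
    transpose. *)
Lemma rep_equiv_signed_bij : cancel g g' -> cancel g' g ->
  (forall i S S', B i S S' = (-1) ^+ e S * (-1) ^+ e S' * A i (g S) (g S')) ->
  rep_equiv A B.
Proof.
move=> gK g'K BE.
have sgnK S : (-1) ^+ e S * (-1) ^+ e S = 1 :> R[i] by rewrite -expr2 sqrr_sign.
have sum1 (T : finType) (x : T) (f : T -> R[i]) :
    (forall y, y != x -> f y = 0) -> \sum_y f y = f x.
  by move=> f0; rewrite (bigD1 x) //= big1 ?addr0.
pose P S t : R[i] := (-1) ^+ e S * (t == g S)%:R.
exists P, (fun t S => P S t); split; [|split].
- move=> S S'; rewrite /opmul (sum1 _ (g S)) => [|t /negbTE nt]; last first.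
    by rewrite /P nt mulr0 mul0r.
  rewrite /P eqxx mulr1 (can_eq gK) /opid; have [->|_] := eqVneq S S'.
    by rewrite mulr1 sgnK.
  by rewrite !mulr0.
- move=> t t'; rewrite /opmul (sum1 _ (g' t)) => [|S nS]; last first.
    rewrite /P; have /negbTE-> : t != g S by apply: contra_neq nS => ->; rewrite gK.
    by rewrite mulr0 mul0r.
  rewrite /P g'K eqxx mulr1 mulrA sgnK mul1r /opid eq_sym //.
move=> i S v; rewrite /opmul (sum1 _ (g S)) => [|t /negbTE nt]; last first.
  by rewrite /P nt mulr0 mul0r.
rewrite (sum1 _ (g' v)) => [|S' nS]; last first.
  rewrite /P; have /negbTE-> : v != g S' by apply: contra_neq nS => ->; rewrite gK.
  by rewrite !mulr0.
by rewrite /P BE g'K !eqxx !mulr1 [RHS]mulrAC -[_ * _ * (-1) ^+ _]mulrA sgnK mulr1.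
Qed.

End SignedBijection.

(** [h] relabels the basis while keeping the enumeration order of [T]; the resulting lists need not
    be increasing in any order on [U]. *)
Lemma ext_pow_minor (R : realType) (T : finType) (U : eqType) (u0 : U) (b : nat)
    (A : op R T T) (f : U -> U -> R[i]) (h : T -> U) (S S' : ExtIdx T b) :
  (forall x y, A x y = f (h x) (h y)) ->
  ext_pow A S S' = minor u0 b f (map h (enum (val S))) (map h (enum (val S'))).
Proof.
move=> Af; congr (\det _); apply/matrixP => i j; rewrite !mxE.
(* A subset of size [b] has an entry at every index below [b], so the default [None] is never
   reached. *)
have nthE (Z : ExtIdx T b) (l : 'I_b) : exists2 x,
    nth None (map Some (enum (val Z))) l = Some x &
    nth u0 (map h (enum (val Z))) l = h x.
  have : (l < size (enum (val Z)))%N by rewrite -cardE (eqP (valP Z)).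
  case: (enum (val Z)) => // x s ls.
  by exists (nth x (x :: s) l); rewrite (nth_map x).
have [x -> ->] := nthE S i; have [y -> ->] := nthE S' j.
exact: Af.
Qed.

(** * Hook sectors in terms of leg sets *)

Section HookSector.
Variables (R : realType) (r : nat) (sgn : bool) (k N a b : nat).
Hypotheses (r3 : (3 <= r)%N) (ltNr : (N.+1 < r)%N) (lbk : (b <= k)%N).
Local Notation z := (qhalf R r sgn).
Local Notation V := (Tab k.+1 r N (hook a b)).

Definition tab_legs (u : V) : {set 'I_N.+1} := legs (val u).

Lemma tab_std (u : V) : std_tableau (hook a b) (val u).
Proof. by case/andP: (valP u). Qed.

Lemma tab_legsE (u : V) : val u = hook_filling k (tab_legs u).
Proof. exact: std_hookE lbk (tab_std u). Qed.

Lemma card_tab_legs (u : V) : #|tab_legs u| = b.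
Proof. exact: card_legs lbk (tab_std u). Qed.

Lemma tab_legs0 (u : V) : ord0 \notin tab_legs u.
Proof. exact: legs0 (tab_std u). Qed.

Lemma tab_legs_inj : injective tab_legs.
Proof. by move=> u v e; apply: val_inj; rewrite !tab_legsE e. Qed.

Lemma tab_legs_onto (X : {set 'I_N.+1}) : (a + b = N)%N -> (k.+2 <= r)%N -> (a.+1 <= r - k.+1)%N ->
  ord0 \notin X -> #|X| = b -> exists u, tab_legs u = X.
Proof.
move=> eN lkr lar X0 cX.
have st := std_hook_filling eN lbk X0 cX.
have ad : adm_std r (hook a b) (hook_filling k X).
  by rewrite /adm_std st (adm_std_hook lbk st).
by exists (Sub (hook_filling k X) ad); rewrite /tab_legs SubK legs_hook_filling ?cX.
Qed.

(** The value of $\alpha$ when the smaller of the two entries is in the leg and the larger in the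
    arm. It depends on [i] only, not on the hook, which is what makes different hooks comparable. *)
Definition leg_coef (i : nat) : R[i] := qproj R r sgn (- i.+1%:Z).

Lemma rhoJW_hook (i : 'I_N) (u v : V) :
  rhoJW z i u v =
  set_op (z ^+ 2) (leg_coef i) (sqrtC (leg_coef i * (1 - leg_coef i)))
    (inord i) (inord i.+1) (tab_legs u) (tab_legs v).
Proof.
set m : 'I_N.+1 := inord i; set m' : 'I_N.+1 := inord i.+1.
have mi : m = i :> nat by rewrite inordK // ltnS ltnW.
have adj : m' = m.+1 :> nat by rewrite mi inordK // ltnS.
set c := leg_coef i; set be := sqrtC _.
have ir : (0 < i.+1 < r)%N by have := ltn_ord i; lia.
have cN : qproj R r sgn i.+1%:Z = 1 - c by rewrite -qprojN.
have cX : (#|tab_legs v| <= k)%N by rewrite card_tab_legs.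
have alphaE : alpha z (val v) i = set_weight c m m' (tab_legs v).
  have -> : alpha z (val v) i = qproj R r sgn (dcont (val v) m m') by [].
  rewrite tab_legsE dcont_hook_filling // mi /set_weight.
  by do 2!case: (_ \in _) => //; rewrite ?qproj1 ?qprojN1.
rewrite /rhoJW /Eop /opid /set_op (inj_eq tab_legs_inj) alphaE; congr (_ - _ * (_ + _)).
rewrite /beta alphaE /set_weight /set_coupling.
have [dX|dX] := boolP ((m \in tab_legs v) (+) (m' \in tab_legs v)); last first.
  (* Both entries in the leg, or both in the arm: $\alpha$ is 1 or 0, so $\beta$ vanishes. *)
  by move: dX; case: (m \in _); case: (m' \in _) => //= _; rewrite ?subrr ?mul0r ?mulr0 sqrtC0 !mulr0.
have -> : (val u == swap_ent i (val v)) = (tab_legs u == tperm m m' @: tab_legs v).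
  have -> : swap_ent i (val v) = hook_filling k (tperm m m' @: tab_legs v).
    by rewrite hook_filling_swap // -tab_legsE.
  apply/eqP/eqP => [e|e]; last by rewrite tab_legsE e.
  rewrite /tab_legs e legs_hook_filling // card_imset //; exact: perm_inj.
congr (_ * _).
(* The product $\alpha(1-\alpha)$ is the same for [c] and [1 - c], so both mixed cases take the same
   square root. *)
move: dX; case: (m \in _); case: (m' \in _) => //= _.
by rewrite subKr mulrC.
Qed.

End HookSector.

(** Both sides are written through leg sets and compared by [minor_set_op]. Rows and legs are
    counted as [k.+1] and [b.+1], so the power to cancel is $q^b$. *)
Lemma hook_sector_equiv (R : realType) (r : nat) (sgn : bool) (k N a b c : nat) :
  (3 <= r)%N -> (N.+1 < r)%N -> (a + b.+1 = N)%N -> (c + 1 = N)%N -> (b < k)%N ->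
  (k.+2 <= r)%N -> (a.+1 <= r - k.+1)%N ->
  rep_equiv (@rhoJW R (qhalf R r sgn) k.+1 r N (hook a b.+1))
    (fun i S S' => ((qhalf R r sgn ^+ 2) ^- b) *
       @ext_pow R _ b.+1 (@rhoJW R (qhalf R r sgn) 2 r N (hook c 1) i) S S').
Proof.
move=> r3 ltNr eN eN1 lbk lkr lar.
set z := qhalf R r sgn.
set T := Tab 2 r N (hook c 1).
have q0 : z ^+ 2 != 0 by rewrite expf_neq0 // qhalf_neq0.
(* A Burau tableau has a single leg entry [h u], and [h] is a bijection onto the nonzero entries. *)
have /fin_all_exists[h hE] (u : T) : exists x, tab_legs u = [set x].
  by apply/cards1P; rewrite card_tab_legs.
have h_inj : injective h by move=> u v e; apply: (@tab_legs_inj r 1 N c 1) => //; rewrite !hE e.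
have h0 u : h u != ord0.
  by have := @tab_legs0 r 1 N c 1 u; rewrite hE inE eq_sym.
have h_onto x : x != ord0 -> exists u, h u = x.
  move=> x0; have [||||u] := @tab_legs_onto r 1 N c 1 isT [set x] eN1.
  - by [].
  - by lia.
  - by rewrite inE eq_sym.
  - by rewrite cards1.
  by rewrite hE => /set1_inj; exists u.
pose XS (S : ExtIdx T b.+1) := h @: val S.
have cXS S : #|XS S| = b.+1 by rewrite card_imset // (eqP (valP S)).
have XS0 S : ord0 \notin XS S.
  by apply/imsetP => -[u _ e]; have := h0 u; rewrite -e eqxx.
have XS_inj : injective XS by move=> S S' /(imset_inj h_inj) e; apply: val_inj.
pose V := Tab k.+1 r N (hook a b.+1).
have leg_inj : injective (@tab_legs r k N a b.+1) := tab_legs_inj lbk.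
have /fin_all_exists[g gE] (S : ExtIdx T b.+1) : exists t : V, tab_legs t = XS S.
  exact: tab_legs_onto.
have /fin_all_exists[g' g'E] (t : V) : exists S : ExtIdx T b.+1, XS S = tab_legs t.
  have e : h @: [set u | h u \in tab_legs t] = tab_legs t.
    apply/setP => x; apply/imsetP/idP => [[u]|xt]; first by rewrite inE => hu ->.
    have x0 : x != ord0 by apply: contraTneq xt => ->; apply: tab_legs0.
    by have [u hu] := h_onto x x0; exists u; [rewrite in_set hu|rewrite hu].
  have cS : #|[set u | h u \in tab_legs t]| == b.+1.
    by rewrite -(card_imset _ h_inj) e card_tab_legs.
  by exists (exist (fun S : {set T} => #|S| == b.+1) _ cS).
(* [e S] is the parity of the permutation sorting the leg entries of the tableaux in [S], listed in
   the enumeration order of [T]. *)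
have /fin_all_exists[e eE] (S : ExtIdx T b.+1) : exists e : bool,
    (forall f s', minor ord0 b.+1 f (map h (enum (val S))) s' =
       (-1) ^+ e * minor ord0 b.+1 f (enum (XS S)) s' :> R[i]) /\
    (forall f s', minor ord0 b.+1 f s' (map h (enum (val S))) =
       (-1) ^+ e * minor ord0 b.+1 f s' (enum (XS S)) :> R[i]).
  apply: minor_perm; first by rewrite size_map -cardE (eqP (valP S)).
  apply: uniq_perm; rewrite ?enum_uniq ?map_inj_uniq ?enum_uniq // => x.
  rewrite mem_enum; apply/mapP/imsetP => -[u us ->]; exists u => //.
    by rewrite mem_enum in us.
  by rewrite mem_enum.
apply: (@rep_equiv_signed_bij _ _ _ _ _ _ g g' e).
- by move=> S; apply: XS_inj; rewrite g'E gE.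
- by move=> t; apply: leg_inj; rewrite gE g'E.
move=> i S S'; rewrite (rhoJW_hook R sgn r3 ltNr lbk) !gE.
rewrite (ext_pow_minor ord0 (f := point_op (z ^+ 2) (leg_coef R r sgn i)
  (sqrtC (leg_coef R r sgn i * (1 - leg_coef R r sgn i))) (inord i) (inord i.+1)) (h := h)); last first.
  by move=> x y; rewrite (rhoJW_hook R sgn r3 ltNr) // !hE.
have [er _] := eE S; have [_ ec] := eE S'; rewrite er ec.
(* [sqrtCK] supplies the relation $\beta^2=\alpha(1-\alpha)$; the factor $q^b$ produced here cancels
   the character. *)
rewrite minor_set_op ?cXS ?sqrtCK //; last first.
  by rewrite !inordK ?ltnS ?ltn_ord ?(ltnW (ltn_ord i)).
rewrite !mulrA; congr (_ * _).
by rewrite [LHS]mulrC !mulrA divff ?mul1r // expf_neq0.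
Qed.

Theorem theorem2p5 (R : realType) (r : nat) (sgn : bool) (k a b : nat) :
  (3 <= r)%N -> (1 <= a)%N -> (1 <= b)%N ->
  admissible k r (hook a b) ->
  (a + b < r - 1)%N ->
  exists psi : 'I_(a + b) -> R[i],
    braid_character psi /\
    rep_equiv (@rhoJW R (qhalf R r sgn) k r (a + b) (hook a b))
              (fun i S S' => psi i *
                 @ext_pow R _ b (@rhoJW R (qhalf R r sgn) 2 r (a + b) [:: (a + b)%N; 1%N] i) S S').
Proof.
move=> r3 a1 b1 adm lab.
have [k' [-> lbk lkr lar]] := admissible_hook lab b1 adm.
case: a a1 lab lar {adm} => // a _ lab lar.
case: b b1 lab lbk => // b _ lab lbk.
(* [b] now stands for the original [b] minus one, so this is $q^{-(b-1)}$ in the original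
   notation. *)
exists (fun=> (qhalf R r sgn ^+ 2) ^- b); split.
  split=> [i|]; first by rewrite normrV ?normrX ?normr_qhalf ?expr1n ?invr1 // unitfE !expf_neq0 ?qhalf_neq0.
  by split=> *; rewrite // mulrC.
(* With [c = a + b.+1], the shape [hook c 1] is convertible to the Burau shape, as [a.+1 + b.+1]
   reduces to [c.+1]. *)
by apply: (@hook_sector_equiv R r sgn k' _ a.+1 b (a + b.+1)) => //; lia.
Qed.
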